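(* For every $n\in\mathbb Z$ and every $j\in\{0,1,\dots,r+1\}$, $$c_j=Z_j^{(G_r)}\bigl(y_{1,n},y_{2,n},\dots,y_{2r+1,n}\bigr),$$ where $c_j$ are the conserved quantities defined below. In particular, taking $n=0$, $c_j$ is the $j$-particle hard particle partition function on $G_r$ with vertex weights $y_{2\alpha-1}=\frac{R_{\alpha-1,0}R_{\alpha,1}}{R_{\alpha,0}R_{\alpha-1,1}}$ ($1\le\alpha\le r+1$) and $y_{2\alpha}=\frac{R_{\alpha-1,0}R_{\alpha+1,1}}{R_{\alpha,0}R_{\alpha,1}}$ ($1\le\alpha\le r$).
   Context: Fix $r\ge1$, $I_r=\{1,\dots,r\}$. Let $R_{1,0},\dots,R_{r,0},R_{1,1},\dots,R_{r,1}$ be algebraically independent indeterminates over $\mathbb Q$ and $(R_{\alpha,n})_{0\le\alpha\le r+1,n\in\mathbb Z}$ the $A_r$ $Q$-system: the unique family of nonzero elements of $\mathbb Q(R_{1,0},\dots,R_{r,1})$ with these initial values, $R_{0,n}=R_{r+1,n}=1$, and $R_{\alpha,n+1}R_{\alpha,n-1}=R_{\alpha,n}^2+R_{\alpha+1,n}R_{\alpha-1,n}$ ($\alpha\in I_r$, $n\in\mathbb Z$). Conserved quantities: for $k\in\{0,\dots,r+1\}$, $c_k$ is the determinant of the matrix obtained from the $(r+2)\times(r+2)$ matrix $(R_{1,n+i+j-r-3})_{1\le i,j\le r+2}$ by deleting row $r+2$ and column $r+2-k$; this is independent of $n$. Weights: $y_{2\alpha-1,n}=\frac{R_{\alpha-1,n}R_{\alpha,n+1}}{R_{\alpha,n}R_{\alpha-1,n+1}}$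 for $1\le\alpha\le r+1$ and $y_{2\alpha,n}=\frac{R_{\alpha-1,n}R_{\alpha+1,n+1}}{R_{\alpha,n}R_{\alpha,n+1}}$ for $1\le\alpha\le r$. The graph $G_r$ has vertices $1,\dots,2r+1$ and edges $\{1,2\}$, $\{2k,2k+1\}$ for $1\le k\le r$, and $\{2k-2,2k\}$, $\{2k-1,2k\}$ for $2\le k\le r$. A hard particle configuration on a graph is a set of vertices no two of which are joined by an edge. Given vertex weights $y_1,\dots,y_{2r+1}$, the weight of a configuration $C$ is $\prod_{i\in C}y_i$; $Z_j^{(G_r)}(y_1,\dots,y_{2r+1})$ denotes the sum of the weights of all hard particle configurations on $G_r$ of cardinality $j$. *)

(* Defs.v *)
From HB Require Import structures.
From mathcomp Require Import all_boot all_order all_algebra.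
Set Implicit Arguments. Unset Strict Implicit. Unset Printing Implicit Defensive.
Import Order.TTheory GRing.Theory Num.Theory.
Local Open Scope ring_scope.

Fixpoint mpoly (m : nat) : idomainType :=
  if m is m'.+1 then ({poly mpoly m'} : idomainType) else (rat : idomainType).

Fixpoint mvar (m i : nat) : mpoly m :=
  match m return mpoly m with
  | 0 => 0
  | m'.+1 => if i == m' then 'X else (mvar m' i)%:P
  end.

Definition ratfun (m : nat) : fieldType := {fraction (mpoly m)}.

Definition xvar (m i : nat) : ratfun m := FracField.tofrac (mvar m i).

(* Edges of G_r on vertices 1..2r+1 (1-based), oriented as listed in the
   paper: {1,2}, {2k,2k+1} (1<=k<=r), {2k-2,2k}, {2k-1,2k} (2<=k<=r). *)
Definition Gedge (r a b : nat) : bool :=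
  [|| (a == 1%N) && (b == 2%N),
      [exists k : 'I_r.+1, [&& (1 <= k)%N, a == (2 * k)%N & b == (2 * k).+1]],
      [exists k : 'I_r.+1, [&& (2 <= k)%N, a == (2 * k - 2)%N & b == (2 * k)%N]]
    | [exists k : 'I_r.+1, [&& (2 <= k)%N, a == (2 * k - 1)%N & b == (2 * k)%N]]].

Definition Gadj (r a b : nat) : bool := Gedge r a b || Gedge r b a.

(* Vertex v : 'I_(2r+1) stands for vertex v+1 of G_r.
   A hard particle configuration: no two of its vertices are adjacent. *)
Definition hard_particle (r : nat) (C : {set 'I_(2 * r).+1}) : bool :=
  [forall u in C, forall v in C, ~~ Gadj r u.+1 v.+1].

(* Z_j^{(G_r)}(y_1, ..., y_{2r+1}), with y given as a function of the
   1-based vertex label. *)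
Definition Zhard (K : fieldType) (r j : nat) (y : nat -> K) : K :=
  \sum_(C : {set 'I_(2 * r).+1} | hard_particle C && (#|C| == j))
     \prod_(v in C) y v.+1.

Definition yweight (K : fieldType) (R : nat -> int -> K) (n : int) (v : nat) : K :=
  if odd v then
    let a := v.+1./2 in
    R a.-1 n * R a (n + 1) / (R a n * R a.-1 (n + 1))
  else
    let a := v./2 in
    R a.-1 n * R a.+1 (n + 1) / (R a n * R a (n + 1)).

(* c_k computed at time n: the determinant of the (r+2)x(r+2) matrix
   (R_{1, n+i+j-r-3})_{1<=i,j<=r+2} with row r+2 and column r+2-k deleted.
   With 0-based indices, row i (0<=i<=r) and the kept columns are
   lift j0 j where j0 = r+1-k is the deleted (0-based) column. *)
Definition cons_qty (K : fieldType) (R : nat -> int -> K) (r k : nat) (n : int) : K :=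
  let j0 : 'I_(r.+2) := inord (r.+1 - k) in
  \det (\matrix_(i < r.+1, j < r.+1)
          R 1%N (n + (i%:Z) + ((lift j0 j : nat)%:Z) - (r%:Z) - 1)).

(* Main.v *)
Require Import Defs.
From HB Require Import structures.
From mathcomp Require Import all_boot all_order all_algebra.
From mathcomp Require Import ring zify.
Import Order.TTheory GRing.Theory Num.Theory.
Local Open Scope ring_scope.

Set Implicit Arguments.
Unset Strict Implicit.
Unset Printing Implicit Defensive.

(** Let [F_a^(n)] be the generating polynomial of hard particles on the vertices
    [1, ..., 2a-1] with weights [y_{i,n}]. Removing the last two vertices gives
    [F_{a+1} = (1 + y_{2a+1} X) F_a + y_{2a} X F_{a-1}], and the Q-system turns
    this into the time evolution [F_a^(n+1) = F_a^(n) + y_{2a,n} X F_{a-1}^(n)].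
    With [R_{r+2} = 0] the last term vanishes for [a = r+1], so [F_{r+1}] is
    conserved. Pairing a polynomial [p] with [R_1] by
    [L_m(p) = sum_k (-1)^k p_k R_{1,m-k}], the two recursions show that
    [L_m(F_a^(n))] vanishes for [n < m <= n+a] and is a ratio of [R]'s at
    [m = n] and [m = n+a+1]. Hence the Hankel matrix of [R_1], multiplied by the
    unitriangular matrix of coefficients of the [F_a], becomes triangular, so its
    determinant of size [r+1] is [R_{r+1} = 1]; and the coefficients of
    [F_{r+1}], up to sign, span the kernel of the [(r+1) x (r+2)] Hankel matrix.
    Cramer's rule identifies its maximal minors [c_j] with these coefficients. *)

(** * Independence polynomials of a finite graph *)

Section IndependencePolynomial.

Variables (T : finType) (adj : rel T) (S : comNzRingType) (w : T -> S).
Hypotheses (adj_sym : symmetric adj) (adj_irr : irreflexive adj).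

Definition independent (C : {set T}) : bool :=
  [forall u in C, forall v in C, ~~ adj u v].

Definition indep_sum (A : {set T}) : S :=
  \sum_(C : {set T} | independent C && (C \subset A)) \prod_(v in C) w v.

Lemma independentP (C : {set T}) :
  reflect {in C &, forall u v, ~~ adj u v} (independent C).
Proof.
apply: (iffP forall_inP) => [H u v uC vC|H u uC]; first exact: (forall_inP (H u uC)).
by apply/forall_inP => v vC; apply: H.
Qed.

Lemma indep_sum0 : indep_sum set0 = 1.
Proof.
rewrite /indep_sum (big_pred1 set0) ?big_set0 // => C; rewrite subset0 /=.
case: eqVneq => [->|_]; rewrite ?andbF ?andbT //.
by apply/independentP => u v; rewrite inE.
Qed.

(** Split the configurations by whether they contain [v]. Removing [v] from those that do gives a
    bijection onto the configurations among the non-neighbours of [v] in [A]. *)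
Lemma indep_sum_setU1 (v : T) (A : {set T}) : v \notin A ->
  indep_sum (v |: A) = indep_sum A + w v * indep_sum [set u in A | ~~ adj u v].
Proof.
move=> vA; rewrite /indep_sum (bigID (fun C : {set T} => v \in C)) /= addrC.
congr (_ + _).
  apply: eq_bigl => C; rewrite -andbA; congr (_ && _).
  apply/andP/idP => [[/subsetP CA vC]|CA].
    apply/subsetP => u uC; have := CA _ uC; rewrite !inE => /orP[/eqP uv|//].
    by rewrite -uv uC in vC.
  split; first exact: subset_trans CA (subsetUr _ _).
  by apply: contra vA => /(subsetP CA).
rewrite big_distrr /= (reindex_onto (fun C => v |: C) (fun C => C :\ v)) /=; last first.
  by move=> C /andP[_ vC]; rewrite setD1K.
have vD (D : {set T}) : D \subset [set u in A | ~~ adj u v] -> v \notin D.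
  by move=> DA; apply: contra vA => /(subsetP DA); rewrite inE => /andP[].
have eD (D : {set T}) : ((v |: D) :\ v == D) = (v \notin D).
  apply/eqP/idP => [<-|vnD]; first by rewrite !inE eqxx.
  by rewrite setU1K.
apply: eq_big => [D|D]; last first.
  by rewrite eD => /andP[_ vnD]; rewrite big_setU1.
rewrite setU11 andbT eD; apply/idP/idP.
  case/andP=> /andP[/independentP iD DA] vnD; apply/andP; split.
    by apply/independentP => x y xD yD; apply: iD; rewrite !inE (xD, yD) ?yD orbT.
  apply/subsetP => x xD; have := subsetP DA x; rewrite !inE xD orbT => /(_ isT).
  case: eqVneq => [xv|_ /= ->] /=; first by rewrite -xv xD in vnD.
  by apply: iD; rewrite !inE ?eqxx ?xD ?orbT.
case/andP=> /independentP iD DA; rewrite (vD _ DA) andbT; apply/andP; split.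
  have nadj x : x \in D -> ~~ adj x v by move=> /(subsetP DA); rewrite inE => /andP[].
  apply/independentP => x y; rewrite !inE => /orP[/eqP->|xD] /orP[/eqP->|yD].
  - by rewrite adj_irr.
  - by rewrite adj_sym nadj.
  - exact: nadj.
  - exact: iD.
apply: setUS; apply: subset_trans DA _; apply/subsetP => x.
by rewrite inE => /andP[].
Qed.

End IndependencePolynomial.

Arguments indep_sum {T} adj {S} w A.

(** * Hard particles on the graph: recursion along the vertex order *)

Section HardParticles.

Variable K : fieldType.

Fixpoint hp_poly (y : nat -> K) (a : nat) : {poly K} :=
  match a with
  | 0 => 1
  | b.+1 =>
    match b with
    | 0 => 1 + y 1%N *: 'X
    | c.+1 => hp_poly y b + (y b.*2 *: 'X) * hp_poly y c
                          + (y b.*2.+1 *: 'X) * hp_poly y b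
    end
  end.

Lemma hp_polySS (y : nat -> K) a :
  hp_poly y a.+2 = hp_poly y a.+1 + (y a.+1.*2 *: 'X) * hp_poly y a
                   + (y a.+1.*2.+1 *: 'X) * hp_poly y a.+1.
Proof. by []. Qed.

Lemma coef0_hp_poly (y : nat -> K) a : (hp_poly y a)`_0 = 1.
Proof.
suff: (hp_poly y a)`_0 = 1 /\ (hp_poly y a.+1)`_0 = 1 by case.
elim: a => [|a [IH1 IH2]]; first by rewrite /= !coefE mulr0 addr0.
by split=> //; rewrite hp_polySS !coefD -!scalerAl !coefZ !coefXM /= !mulr0 !addr0.
Qed.

Lemma size_hp_poly (y : nat -> K) a : (size (hp_poly y a) <= a.+1)%N.
Proof.
have szX (c : K) (p : {poly K}) d : (size p <= d)%N -> (size ((c *: 'X) * p)%R <= d.+1)%N.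
  move=> sp; rewrite -scalerAl; apply: leq_trans (size_scale_leq _ _) _.
  by rewrite (leq_trans (size_mul_leq _ _)) // size_polyX.
have szD (p q : {poly K}) d :
    (size p <= d -> size q <= d -> size (p + q)%R <= d)%N.
  by move=> sp sq; apply: leq_trans (size_polyD _ _) _; rewrite geq_max sp.
suff: (size (hp_poly y a) <= a.+1)%N /\ (size (hp_poly y a.+1) <= a.+2)%N by case.
elim: a => [|a [IH1 IH2]].
  split; rewrite /= ?size_poly1 //; apply: szD; first by rewrite size_poly1.
  by rewrite -[_ *: 'X]mulr1; apply: szX; rewrite size_poly1.
split=> //; rewrite hp_polySS; apply: (szD); last exact: szX.
by apply: szD; [exact: leqW | apply: szX; exact: leqW].
Qed.

Lemma Gadj_sym r : symmetric (Gadj r).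
Proof. by move=> a b; rewrite /Gadj orbC. Qed.

(** Eliminates the existential quantifiers, leaving arithmetic conditions that [lia] can decide. *)
Lemma GedgeE r a b : Gedge r a b =
  [|| (a == 1%N) && (b == 2%N),
      [&& ~~ odd a, 0 < a, a <= r.*2 & b == a.+1]%N,
      [&& ~~ odd b, 4 <= b, b <= r.*2 & b == a.+2]%N
    | [&& ~~ odd b, 4 <= b, b <= r.*2 & b == a.+1]%N].
Proof.
rewrite /Gedge; congr [|| _, _, _ | _].
- apply/existsP/idP => [[k /and3P[h1 /eqP h2 /eqP h3]]|h].
    by have := ltn_ord k; lia.
  have hk : (a./2 < r.+1)%N by lia.
  by exists (Ordinal hk) => /=; lia.
- apply/existsP/idP => [[k /and3P[h1 /eqP h2 /eqP h3]]|h].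
    by have := ltn_ord k; lia.
  have hk : (b./2 < r.+1)%N by lia.
  by exists (Ordinal hk) => /=; lia.
- apply/existsP/idP => [[k /and3P[h1 /eqP h2 /eqP h3]]|h].
    by have := ltn_ord k; lia.
  have hk : (b./2 < r.+1)%N by lia.
  by exists (Ordinal hk) => /=; lia.
Qed.

Lemma Gadj_odd r u a : (0 < u <= a.*2)%N -> (a <= r)%N ->
  Gadj r u a.*2.+1 = (u == a.*2).
Proof.
move=> hu ha; rewrite /Gadj !GedgeE; apply/idP/eqP => [|->].
  by case/orP=> /or4P[] h; lia.
by apply/orP; left; apply/or4P/Or42; rewrite odd_double; lia.
Qed.

Lemma Gadj_even r u a : (0 < u < a.*2)%N -> (a <= r)%N ->
  Gadj r u a.*2 = (a.*2 <= u.+2)%N.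
Proof.
move=> hu ha; rewrite /Gadj !GedgeE; apply/idP/idP => [|h].
  by case/orP=> /or4P[] h; lia.
apply/orP; left; apply/or4P; have [a1|a1] := leqP a 1.
  by apply: Or41; lia.
have [e|a2] := eqVneq a.*2 u.+2; first by apply: Or43; lia.
by apply: Or44; lia.
Qed.

Lemma Gadj_irr r : irreflexive (Gadj r).
Proof.
move=> a; rewrite /Gadj orbb GedgeE; apply/negbTE/negP.
by case/or4P=> h; lia.
Qed.

Section Graph.

Variables (r : nat) (y : nat -> K).

Let adj : rel 'I_(2 * r).+1 := fun u v => Gadj r u.+1 v.+1.
Let w (v : 'I_(2 * r).+1) : {poly K} := y v.+1 *: 'X.
Let below (N : nat) := [set u : 'I_(2 * r).+1 | (u < N)%N].
Let sumb (N : nat) := indep_sum adj w (below N).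

(** The hypothesis says that the earlier neighbours of vertex [N.+1] are the consecutive vertices
    [M.+1], ..., [N]. Occupying [N.+1] therefore leaves another initial segment, so the recursion
    stays within the sums [sumb]. *)
Let sumb_rec N M : (M <= N <= 2 * r)%N ->
  (forall u, (u < N)%N -> ~~ Gadj r u.+1 N.+1 = (u < M)%N) ->
  sumb N.+1 = sumb N + (y N.+1 *: 'X) * sumb M.
Proof.
case/andP=> MN Nr adjN; have hN : (N < (2 * r).+1)%N by [].
have eN : below N.+1 = Ordinal hN |: below N.
  by apply/setP => u; rewrite !inE ltnS leq_eqVlt.
rewrite /sumb eN indep_sum_setU1; first last.
- by rewrite inE /= ltnn.
- by move=> u; exact: Gadj_irr.
- by move=> u v; exact: Gadj_sym.
congr (_ + _ * indep_sum _ _ _); apply/setP => u; rewrite !inE /adj /=.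
by case: ltnP => [/adjN->//|]; lia.
Qed.

Lemma indep_sum_below a : (a <= r.+1)%N -> sumb a.*2.-1 = hp_poly y a.
Proof.
have s0 : sumb 0 = 1.
  by rewrite -(@indep_sum0 _ adj _ w); congr indep_sum; apply/setP => u; rewrite !inE.
have s1 : sumb 1 = hp_poly y 1.
  by rewrite (@sumb_rec 0 0) // s0 mulr1.
case: a => [|a] // ha.
suff: sumb a.*2.-1 = hp_poly y a /\ sumb a.+1.*2.-1 = hp_poly y a.+1 by case.
elim: a ha => [|a IH] ha; first by split.
have [IH1 IH2] := IH (ltnW ha); split=> //.
rewrite hp_polySS -IH1 -IH2 !doubleS /=.
(* Adjoining vertex $2a+3$ excludes only vertex $2a+2$. *)
rewrite (@sumb_rec a.*2.+2 a.*2.+1); last 2 first.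
- lia.
- by move=> u hu; rewrite -[a.*2.+3]/(a.+1.*2.+1) Gadj_odd //; lia.
(* Adjoining vertex $2a+2$ excludes $2a+1$ and $2a$; for [a = 0] the truncated [a.*2.-1] is 0, which
   correctly excludes vertex 1 alone. *)
rewrite (@sumb_rec a.*2.+1 a.*2.-1); last 2 first.
- lia.
- by move=> u hu; rewrite -[a.*2.+2]/(a.+1.*2) Gadj_even //; lia.
by [].
Qed.

(** Each vertex weight carries one factor ['X], so the degree counts particles. *)
Lemma ZhardE j : Zhard r j y = (hp_poly y r.+1)`_j.
Proof.
rewrite -indep_sum_below // /sumb /indep_sum coef_sum.
rewrite /Zhard big_mkcondr /=; apply: eq_big => [C|C _].
  suff -> : C \subset below r.+1.*2.-1 by rewrite andbT.
  by apply/subsetP => u _; rewrite inE; have := ltn_ord u; lia.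
rewrite scaler_prod prodr_const coefZ coefXn eq_sym.
by case: eqP => _; rewrite ?mulr1 ?mulr0.
Qed.

End Graph.

End HardParticles.

(** * Pairing polynomials with a two-sided sequence *)

Section ShiftPairing.

Variables (K : fieldType) (x : int -> K).

(** This is the value at [m] of $p(-S)x$, where $S$ is the shift $(Sx)_m = x_{m-1}$; multiplication
    by ['X] thus acts as $-S$. *)
Definition shift_pairing (p : {poly K}) (m : int) : K :=
  \sum_(k < size p) (-1) ^+ k * p`_k * x (m - k%:Z).

Lemma shift_pairing_wide N (p : {poly K}) m : (size p <= N)%N ->
  shift_pairing p m = \sum_(k < N) (-1) ^+ k * p`_k * x (m - k%:Z).
Proof.
move=> sp; rewrite /shift_pairing.
rewrite (big_ord_widen _ (fun k => (-1) ^+ k * p`_k * x (m - k%:Z)) sp).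
rewrite big_mkcond; apply: eq_bigr => k _.
by case: ltnP => // /(nth_default 0) ->; rewrite mulr0 mul0r.
Qed.

Lemma shift_pairing1 m : shift_pairing 1 m = x m.
Proof.
by rewrite /shift_pairing size_poly1 big_ord1 coefC /= expr0 !mul1r subr0.
Qed.

Lemma shift_pairingD p q m :
  shift_pairing (p + q) m = shift_pairing p m + shift_pairing q m.
Proof.
pose N := maxn (size p) (size q).
rewrite !(@shift_pairing_wide N) ?leq_maxl ?leq_maxr ?size_polyD // -big_split.
by apply: eq_bigr => k _; rewrite coefD mulrDr mulrDl.
Qed.

Lemma shift_pairing_scaleX c p m :
  shift_pairing ((c *: 'X) * p) m = - c * shift_pairing p (m - 1).
Proof.
rewrite -scalerAl (@shift_pairing_wide (size p).+1); last first.
  apply: leq_trans (size_scale_leq _ _) (leq_trans (size_mul_leq _ _) _).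
  by rewrite size_polyX.
rewrite big_ord_recl coefZ coefXM eqxx !(mulr0, mul0r) add0r mulr_sumr.
apply: eq_bigr => k _; rewrite coefZ coefXM lift0 /= exprS.
have -> : m - k.+1%:Z = m - 1 - k%:Z by lia.
by ring.
Qed.

(** Increasing indices and zero padding up to [N] make the pairing a row of a Hankel matrix times a
    column of signed coefficients. *)
Lemma shift_pairing_rev k N (p : {poly K}) m : (size p <= k.+1)%N -> (k < N)%N ->
  shift_pairing p m =
  \sum_(j < N) (if (j <= k)%N then (-1) ^+ (k - j) * p`_(k - j) else 0)
               * x (m - k%:Z + j%:Z).
Proof.
move=> sp kN; rewrite (shift_pairing_wide _ sp) (reindex_inj rev_ord_inj) /=.
pose g j := (if (j <= k)%N then (-1) ^+ (k - j) * p`_(k - j) else 0)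
            * x (m - k%:Z + j%:Z).
rewrite -[RHS]/(\sum_(j < N) g j) (bigID (fun j : 'I_N => (j < k.+1)%N)) /=.
rewrite [X in _ + X]big1 ?addr0; last first.
  by move=> j; rewrite ltnS /g => /negbTE ->; rewrite mul0r.
rewrite -(big_ord_widen _ g kN); apply: eq_bigr => j _; have jk := ltn_ord j.
by rewrite /g subSS -ltnS jk; congr (_ * x _); lia.
Qed.

End ShiftPairing.

(* Border [M] by the row [delta_{j0}], then replace the last column by the
   kernel vector: both determinants expand along a single entry. *)
Lemma det_col'_ker (S : comNzRingType) p (M : 'M[S]_(p, p.+1)) (v : 'cV[S]_p.+1)
    (j0 : 'I_p.+1) :
  M *m v = 0 -> v ord_max 0 = 1 ->
  \det (col' j0 M) = (-1) ^+ (p + j0) * v j0 0 * \det (col' ord_max M).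
Proof.
move=> Mv0 v1.
pose A := \matrix_(i < p.+1, c < p.+1)
  if unlift ord_max i is Some i' then M i' c else (c == j0)%:R.
pose U := \matrix_(c < p.+1, k < p.+1)
  if k == ord_max then v c 0 else (c == k)%:R.
have detU : \det U = 1.
  rewrite -det_tr det_trig.
    by rewrite big1 // => i _; rewrite !mxE eqxx; case: eqP => [->|].
  apply/is_trig_mxP => i j ij; rewrite !mxE; case: eqP => [ei|_].
    by have := ltn_ord j; move: ij; rewrite ei /=; lia.
  by case: eqP => // ji; rewrite ji ltnn in ij.
have detA : \det A = (-1) ^+ (p + j0) * \det (col' j0 M).
  rewrite (expand_det_row A ord_max) (bigD1 j0) //= big1 => [|c cj].
    rewrite addr0 /cofactor !mxE unlift_none eqxx mul1r; congr (_ * \det _).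
    by apply/matrixP => i j; rewrite !mxE liftK.
  by rewrite !mxE unlift_none (negbTE cj) mul0r.
have AUl i k : k != ord_max -> (A *m U) i k = A i k.
  move=> hk; rewrite mxE (bigD1 k) //= big1 => [|c ck].
    by rewrite [U _ _]mxE (negbTE hk) eqxx mulr1 addr0.
  by rewrite [U _ _]mxE (negbTE hk) (negbTE ck) mulr0.
have AUm i : (A *m U) (lift ord_max i) ord_max = 0.
  transitivity ((M *m v) i 0); last by rewrite Mv0 mxE.
  by rewrite !mxE; apply: eq_bigr => c _; rewrite !mxE liftK eqxx.
have AUmm : (A *m U) ord_max ord_max = v j0 0.
  rewrite mxE (bigD1 j0) //= big1 => [|c cj].
    by rewrite !mxE unlift_none !eqxx mul1r addr0.
  by rewrite !mxE unlift_none (negbTE cj) mul0r.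
have detAU : \det (A *m U) = v j0 0 * \det (col' ord_max M).
  rewrite (expand_det_col _ ord_max) (bigD1 ord_max) //= big1 => [|i im].
    rewrite AUmm addr0 /cofactor -signr_odd oddD addbb mul1r; congr (_ * \det _).
    apply/matrixP => i j.
    by rewrite [LHS]mxE [LHS]mxE AUl ?mxE ?liftK // eq_sym neq_lift.
  by case: (unliftP ord_max i) im => [i' ->|->]; rewrite ?AUm ?mul0r ?eqxx.
move: detAU; rewrite det_mulmx detU mulr1 detA -mulrA => <-.
by rewrite mulrA -exprD -signr_odd oddD addbb mul1r.
Qed.

(** * Time evolution under the Q-system, Hankel determinants and conserved quantities *)

Section QSystem.

Variables (K : fieldType) (r : nat) (R : nat -> int -> K).
Hypothesis R0 : forall n, R 0%N n = 1.
Hypothesis R_neq0 : forall a n, (a <= r.+1)%N -> R a n != 0.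
Hypothesis Rr2 : forall n, R r.+2 n = 0.
Hypothesis R_rec : forall a n, (1 <= a <= r.+1)%N ->
  R a (n + 1) * R a (n - 1) = R a n ^+ 2 + R a.+1 n * R a.-1 n.

Let yo a n := yweight R n a.*2.+1.
Let ye a n := yweight R n a.+1.*2.
Let F a n := hp_poly (yweight R n) a.

Let yoE a n : yo a n = R a n * R a.+1 (n + 1) / (R a.+1 n * R a (n + 1)).
Proof. by rewrite /yo /yweight /= odd_double /= doubleK. Qed.

Let yeE a n : ye a n = R a n * R a.+2 (n + 1) / (R a.+1 n * R a.+1 (n + 1)).
Proof. by rewrite /ye /yweight odd_double /= doubleK. Qed.

Let R_rec2 a n : (a <= r)%N ->
  R a.+2 (n + 1) * R a (n + 1) = R a.+1 (n + 1 + 1) * R a.+1 n - R a.+1 (n + 1) ^+ 2.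
Proof.
move=> ha; have := @R_rec a.+1 (n + 1) _; rewrite addrK => -> //=.
by ring.
Qed.

Let yo0_step n : yo 0 (n + 1) = yo 0 n + ye 0 n.
Proof.
rewrite !yoE yeE !R0; have h := @R_rec2 0 n isT; rewrite R0 mulr1 in h.
rewrite h; field.
by rewrite !R_neq0.
Qed.

(** Both sides equal one monomial ratio: the left by the Q-system relation at index [a.+1], the
    right by the one at [a.+2], both at time [n + 1]. *)
Let y_sum_step a n : (a < r)%N ->
  yo a.+1 (n + 1) + ye a (n + 1) = yo a.+1 n + ye a.+1 n.
Proof.
move=> ha; transitivity (R a.+1 n * R a.+2 (n + 1 + 1) / (R a.+1 (n + 1) * R a.+2 (n + 1))).
  have h := @R_rec2 a n (ltnW ha).
  rewrite yoE yeE.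
  transitivity (R a.+2 (n + 1 + 1) * (R a.+1 (n + 1) ^+ 2 + R a.+2 (n + 1) * R a (n + 1))
     / (R a.+2 (n + 1) * R a.+1 (n + 1 + 1) * R a.+1 (n + 1))).
    by field; rewrite !R_neq0 //; lia.
  rewrite h; field.
  by rewrite !R_neq0 //; lia.
have h := @R_rec2 a.+1 n ha.
rewrite yoE yeE.
transitivity (R a.+1 n * (R a.+2 (n + 1) ^+ 2 + R a.+3 (n + 1) * R a.+1 (n + 1))
     / (R a.+2 n * R a.+1 (n + 1) * R a.+2 (n + 1))); last first.
  by field; rewrite !R_neq0 //; lia.
rewrite h; field.
by rewrite !R_neq0 //; lia.
Qed.

Let y_mul_step a n : (a < r)%N ->
  yo a.+1 (n + 1) * ye a n = ye a (n + 1) * yo a n.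
Proof. by move=> ha; rewrite !yoE !yeE; field; rewrite !R_neq0 //; lia. Qed.


(** The two identities are proved by a joint induction. In the first, the terms in ['X * F a.+1 n]
    match by [y_sum_step] and those in ['X ^+ 2 * F a n] cancel by [y_mul_step]. *)
Lemma hp_poly_step a n : (a <= r)%N ->
  F a.+1 (n + 1) = F a.+1 n + (ye a n *: 'X) * F a n /\
  F a.+1 n = F a (n + 1) + (yo a n *: 'X) * F a n.
Proof.
elim: a => [|a IH] ha.
  by rewrite /F /= -!/(yo 0 _) yo0_step scalerDl !mulr1 addrA.
have [IH1 IH2] := IH (ltnW ha).
have FSS k : F a.+2 k =
    F a.+1 k + (ye a k *: 'X) * F a k + (yo a.+1 k *: 'X) * F a.+1 k by [].
split; last by rewrite FSS IH1.
rewrite !FSS IH1.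
have -> : F a (n + 1) = F a.+1 n - (yo a n *: 'X) * F a n by rewrite IH2 addrK.
have hs : (yo a.+1 (n + 1))%:P + (ye a (n + 1))%:P
          = (yo a.+1 n)%:P + (ye a.+1 n)%:P by rewrite -!polyCD y_sum_step.
have hm : (yo a.+1 (n + 1))%:P * (ye a n)%:P
          = (ye a (n + 1))%:P * (yo a n)%:P by rewrite -!polyCM y_mul_step.
rewrite -!mul_polyC.
transitivity (F a.+1 n + (ye a n)%:P * 'X * F a n
  + ((yo a.+1 (n + 1))%:P + (ye a (n + 1))%:P) * 'X * F a.+1 n
  + ((yo a.+1 (n + 1))%:P * (ye a n)%:P - (ye a (n + 1))%:P * (yo a n)%:P)
    * 'X ^+ 2 * F a n); first by ring.
by rewrite hs hm; ring.
Qed.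

Let L := shift_pairing (R 1%N).

Lemma shift_pairing_hp_poly a : (a <= r.+1)%N -> forall n,
  [/\ forall i : nat, (i < a)%N -> L (F a n) (n + 1 + i%:Z) = 0,
      L (F a n) (n + 1 + a%:Z) = R a.+1 (n + 1) / R a n
    & L (F a n) n = (-1) ^+ a * R a.+1 n / R a n].
Proof.
elim: a => [|a IH] ha n.
  by split=> [//||]; rewrite /L shift_pairing1 R0 divr1 ?addr0 // mul1r.
have {}IH := IH (ltnW ha).
have Lo k m : L (F a.+1 k) m = L (F a (k + 1)) m - yo a k * L (F a k) (m - 1).
  by rewrite (@hp_poly_step _ _ _).2 // /L shift_pairingD shift_pairing_scaleX mulNr.
have Le k m : L (F a.+1 (k + 1)) m = L (F a.+1 k) m - ye a k * L (F a k) (m - 1).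
  by rewrite (@hp_poly_step _ _ _).1 // /L shift_pairingD shift_pairing_scaleX mulNr.
(* The new zero, at the left end of the window, comes from the cancellation of two boundary values
   supplied by the third clause of the induction hypothesis. *)
have vanish k : L (F a.+1 k) (k + 1) = 0.
  rewrite Lo addrK; have [_ _ ->] := IH (k + 1); have [_ _ ->] := IH k.
  by rewrite yoE; field; rewrite !R_neq0 //; lia.
split.
- case=> [|i] hi; first by rewrite addr0.
  rewrite Lo.
  have -> : n + 1 + i.+1%:Z = n + 1 + 1 + i%:Z by lia.
  have -> : n + 1 + 1 + i%:Z - 1 = n + 1 + i%:Z by lia.
  have [z1 _ _] := IH (n + 1); have [z2 _ _] := IH n.
  by rewrite z1 // z2 // mulr0 subr0.
- rewrite Lo.
  have -> : n + 1 + a.+1%:Z = n + 1 + 1 + a%:Z by lia.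
  have -> : n + 1 + 1 + a%:Z - 1 = n + 1 + a%:Z by lia.
  have [_ -> _] := IH (n + 1); have [_ -> _] := IH n.
  rewrite yoE; transitivity ((R a.+2 (n + 1) * R a (n + 1)) / (R a (n + 1) * R a.+1 n)).
    rewrite R_rec2 //; field.
    by rewrite !R_neq0 //; lia.
  by field; rewrite !R_neq0 //; lia.
(* Here [Lo] would call for pairings to the left of the known range; [Le], started one time step
   earlier, reduces to [vanish] and a known boundary value. *)
- have [k ->] : exists k, n = k + 1 by exists (n - 1); rewrite subrK.
  rewrite Le vanish addrK; have [_ _ ->] := IH k.
  rewrite yeE exprS; field.
  by rewrite !R_neq0 //; lia.
Qed.

Lemma det_hankel a s : (a <= r.+1)%N ->
  \det (\matrix_(i < a, j < a) R 1%N (s + i%:Z + j%:Z)) = R a (s + a%:Z - 1).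
Proof.
move=> ha; set H := \matrix_(i, j) _.
(* This time is chosen so that the zeros of the pairing with [G k] fall exactly on rows
   $0,\dots,k-1$ of column [k]. *)
pose G k := F k (s + k%:Z - 1).
pose U := \matrix_(j < a, k < a)
  if (j <= k)%N then (-1) ^+ (k - j) * (G k)`_(k - j) else 0.
have detU : \det U = 1.
  rewrite -det_tr det_trig.
    by rewrite big1 // => i _; rewrite !mxE leqnn subnn mul1r coef0_hp_poly.
  by apply/is_trig_mxP => i j ij; rewrite !mxE leqNgt ij.
have HU i k : (H *m U) i k = L (G k) (s + i%:Z + k%:Z).
  rewrite /L (@shift_pairing_rev _ _ k a) ?size_hp_poly // mxE.
  by apply: eq_bigr => j _; rewrite !mxE mulrC addrK.
rewrite -[LHS]mulr1 -detU -det_mulmx det_trig; last first.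
  apply/is_trig_mxP => i k ik; rewrite HU /G.
  have [|z _ _] := @shift_pairing_hp_poly k _ (s + k%:Z - 1).
    exact: leq_trans (ltnW (ltn_ord k)) ha.
  have -> : s + i%:Z + k%:Z = s + k%:Z - 1 + 1 + i%:Z by lia.
  exact: z.
have diag k : (k < a)%N -> L (G k) (s + k%:Z + k%:Z) = R k.+1 (s + k%:Z) / R k (s + k%:Z - 1).
  move=> ka; have [|_ z _] := @shift_pairing_hp_poly k _ (s + k%:Z - 1).
    exact: leq_trans (ltnW ka) ha.
  by rewrite subrK in z.
under eq_bigr => k _ do rewrite HU diag //.
(* The product of the diagonal entries telescopes: each denominator is the preceding numerator. *)
elim: {H G U detU HU diag} a ha => [|a IH] ha; first by rewrite big_ord0 R0.
rewrite big_ord_recr /= IH ?(ltnW ha) // mulrC divfK ?R_neq0 ?(ltnW ha) //.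
by congr R; lia.
Qed.

Lemma hp_poly_conserved m n : F r.+1 m = F r.+1 n.
Proof.
have step k : F r.+1 (k + 1) = F r.+1 k.
  by rewrite (@hp_poly_step _ _ _).1 // yeE Rr2 mulr0 mul0r scale0r mul0r addr0.
have steps (d : nat) k : F r.+1 (k + d%:Z) = F r.+1 k.
  elim: d => [|d IH]; first by rewrite addr0.
  have -> : k + d.+1%:Z = k + d%:Z + 1 by lia.
  by rewrite step.
wlog mn : m n / m <= n => [H|].
  by have [/H|/ltW/H] := leP m n.
by rewrite -(steps `|n - m|%N m); congr (F _ _); lia.
Qed.

Lemma cons_qty_hp_poly m n j : (forall k, R r.+1 k = 1) -> (j <= r.+1)%N ->
  cons_qty R r j m = (F r.+1 n)`_j.
Proof.
move=> Rr1 hj; rewrite /cons_qty; set j0 := inord _.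
have j0E : j0 = (r.+1 - j)%N :> nat by rewrite inordK // ltnS leq_subr.
pose M := \matrix_(i < r.+1, c < r.+2) R 1%N (m + i%:Z + c%:Z - r%:Z - 1).
(* Coefficients are listed in reverse, so the last entry is the constant term 1 required by
   [det_col'_ker]. *)
pose v := \col_(c < r.+2) ((-1) ^+ (r.+1 - c) * (F r.+1 n)`_(r.+1 - c)).
have Mv0 : M *m v = 0.
  apply/matrixP => i q; rewrite !mxE.
  (* Row [i] computes the pairing at [m + i]; at time [m - 1] the window of zeros covers all [r.+1]
     rows. Conservation then replaces time [m - 1] by [n]. *)
  have [//|z _ _] := @shift_pairing_hp_poly r.+1 _ (m - 1).
  rewrite -[RHS](z i) // /L (@shift_pairing_rev _ _ r.+1 r.+2) ?size_hp_poly //.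
  apply: eq_bigr => c _; rewrite !mxE -ltnS ltn_ord mulrC.
  rewrite (hp_poly_conserved n (m - 1)).
  by congr (_ * R _ _); lia.
have v1 : v ord_max 0 = 1 by rewrite mxE subnn mul1r coef0_hp_poly.
transitivity (\det (col' j0 M)).
  by congr (\det _); apply/matrixP => i k; rewrite !mxE.
rewrite (@det_col'_ker _ _ M v) //.
have -> : \det (col' ord_max M) = 1.
  (* Without its last column, [M] is the square Hankel matrix starting at $s = m-r-1$. *)
  rewrite -(Rr1 (m - r%:Z - 1 + r.+1%:Z - 1)) -det_hankel //; congr (\det _).
  by apply/matrixP => i k; rewrite !mxE lift_max; congr R; lia.
rewrite mulr1 mxE j0E subKn // mulrA -exprD -signr_odd.
by rewrite -addnA subnK // oddD addbb mul1r.
Qed.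

End QSystem.

Theorem mainTheorem6 (r : nat) (hr : (1 <= r)%N)
  (R : nat -> int -> ratfun (2 * r))
  (Hinit0 : forall a : nat, (1 <= a <= r)%N -> R a 0 = xvar (2 * r) a.-1)
  (Hinit1 : forall a : nat, (1 <= a <= r)%N -> R a 1 = xvar (2 * r) (r + a.-1))
  (Hbd0 : forall n : int, R 0%N n = 1)
  (Hbdr : forall n : int, R r.+1 n = 1)
  (Hnz : forall (a : nat) (n : int), (a <= r.+1)%N -> R a n != 0)
  (Hrec : forall (a : nat) (n : int), (1 <= a <= r)%N ->
            R a (n + 1) * R a (n - 1) = R a n ^+ 2 + R a.+1 n * R a.-1 n) :
  forall (m n : int) (j : nat), (j <= r.+1)%N ->
    cons_qty R r j m = Zhard r j (yweight R n).
Proof.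
move=> m n j hj.
(* The hypotheses leave [R r.+2] free; setting it to 0 extends the recursion to [a = r.+1]. *)
pose R' a k := if (a <= r.+1)%N then R a k else 0.
have R'E a k : (a <= r.+1)%N -> R' a k = R a k by rewrite /R' => ->.
(* Only index 1 occurs in [cons_qty], and there the test defining [R'] computes to true. *)
have -> : cons_qty R r j m = cons_qty R' r j m by [].
have -> : Zhard r j (yweight R n) = Zhard r j (yweight R' n).
  apply: eq_bigr => C _; apply: eq_bigr => v _; have hv := ltn_ord v.
  by rewrite /yweight; case: ifP => ov; rewrite !R'E //; lia.
rewrite ZhardE; apply: (@cons_qty_hp_poly _ r R').
- by move=> k; rewrite R'E ?Hbd0 ?Hbdr.
- by move=> a k ha; rewrite R'E // Hnz.
- by move=> k; rewrite /R' ltnn.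
- move=> a k /andP[a0]; rewrite leq_eqVlt ltnS => /predU1P[->|ha].
    by rewrite /R' /= leqnn ltnn !Hbdr mul0r addr0 expr1n mulr1.
  by rewrite !R'E ?Hrec ?a0 //; lia.
- by move=> k; rewrite R'E ?Hbd0 ?Hbdr.
- exact: hj.
Qed.
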